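(* Let $\gamma\in(0,1)$, $N=\lfloor1/\gamma\rfloor$, let $X$ be a branched $\gamma$-rough path, and let $M:\mathcal H_N\to\mathcal H_N$ be a linear map such that: (i) $M$ is multiplicative for the (truncated) forest product and $M\mathbf 1=\mathbf 1$; (ii) $(M\otimes M)\Delta=\Delta M$; (iii) for every non-empty tree $\tau\in\mathcal H_N$, $M\tau=\sum_i\lambda_i\tau_i$ is a finite linear combination of trees $\tau_i$ with $\gamma_{\tau_i}\ge\gamma_\tau$ and $|\tau_i|\le|\tau|$. Let $M^*:\mathcal H_N^*\to\mathcal H_N^*$ be the adjoint of $M$, and let $\tilde M^*:T_N(\mathcal B_N)\to T_N(\mathcal B_N)$ be the linear map multiplicative for (truncated) concatenation with $\tilde M^*\varepsilon=\varepsilon$ and $\tilde M^*\tau=\Psi(M^*\tau)$ for $\tau\in\mathcal B_N$. Then $$\Psi(M^*X)=\tilde M^*\,\Psi(X),$$ i.e. $\Psi(M^*X_{st})=\tilde M^*\Psi(X_{st})$ for all $s,t\in[0,1]$.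
   Context: **Trees and forests.** $\mathcal T$ is the set of (non-planar) rooted trees with nodes decorated by $\{0,\dots,d\}$; $|\tau|$ is the number of nodes and $|\tau|_0$ the number of nodes decorated by $0$; the weight is $\gamma_\tau=(1-\gamma)|\tau|_0+\gamma|\tau|$. $\mathbf 1$ is the empty tree/forest. $\mathcal H$ is the linear span of forests (commutative monomials of trees), with the forest product; $\mathcal H_N$ is the span of forests with at most $N$ nodes in total. $B_+^i(f)$ is the tree obtained by connecting the roots of the trees of the forest $f$ to a new root decorated by $i$. The Butcher–Connes–Kreimer coproduct is the algebra morphism $\Delta:\mathcal H\to\mathcal H\otimes\mathcal H$ with $\Delta\mathbf 1=\mathbf 1\otimes\mathbf 1$ and $\Delta B_+^i(f)=\mathbf 1\otimes B_+^i(f)+(B_+^i\otimes\mathrm{id})\Delta f$. **Dual algebra and branched rough paths.** $\mathcal H_N^*$ is the dual of $\mathcal H_N$, an algebra for the convolution $X\star Y=(X\otimes Y)\Delta$ with unit $\mathbf 1^*$ (equal to $1$ on $\mathbf 1$ and $0$ on other forests). $\mathcal G_N\subset\mathcal H_N^*$ is the group of truncated characters (linear $X$ with $X(\mathbf 1)=1$, $X(fh)=X(f)X(h)$ whenever $fh\in\mathcal H_N$). A branched $\gamma$-rough path is a map $X:[0,1]^2\to\mathcal G_N$ with $X_{tt}=\mathbf 1^*$, $X_{su}\star X_{ut}=X_{st}$ for all $s,u,t$, and $|\langle X_{st},\tau\rangle|\lesssim|t-s|^{\gamma_\tau}$ for every tree $\tau$ with $|\tau|\le N$. $M^*X_{st}=X_{st}\circ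 M$. **The map $\Psi$.** A forest is identified with the element of $\mathcal H_N^*$ equal to $1$ on that forest and $0$ on all other forests. By a theorem of Foissy and Chapoton there is a subspace $\mathcal B=\langle\tau_1,\tau_2,\dots\rangle$ of the linear span of non-empty trees, whose basis elements $\tau_i$ are linear combinations of trees all having the same number $|\tau_i|$ of nodes and the same number $|\tau_i|_0$ of nodes decorated by $0$, ordered with $|\tau_i|\le|\tau_j|$ for $i\le j$, such that, with $\mathcal B_N$ the span of the $\tau_i$ with $|\tau_i|\le N$, every element of $\mathcal H_N^*$ can be written uniquely as $\sum_R\lambda_R\,\tau_{r_1}\star\cdots\star\tau_{r_n}$, the sum running over multi-indices $R=(r_1,\dots,r_n)$, $n\ge0$, with $\sum_i|\tau_{r_i}|\le N$ (the empty $R$ giving $\mathbf 1^*$). Fix such a $\mathcal B$ and basis. $T_N(\mathcal B_N)$ is the span of words $\tau_{r_1}\otimes\cdots\otimes\tau_{r_n}$ in these basis letters with $\sum_i|\tau_{r_i}|\le N$ (empty word $\varepsilon$), with concatenation, where words exceeding the bound are set to $0$. $\Psi:\mathcal H_N^*\to T_N(\mathcal B_N)$ is the linear isomorphism $\tau_{r_1}\star\cdots\star\tau_{r_n}\mapsto\tau_{r_1}\otimes\cdots\otimes\tau_{r_n}$. *)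

(* Defs.v *)
From HB Require Import structures.
From mathcomp Require Import all_boot all_order all_algebra finmap.
From mathcomp Require Import monalg.
From mathcomp Require Import boolp reals exp.

Set Implicit Arguments.
Unset Strict Implicit.
Unset Printing Implicit Defensive.

Import Order.TTheory GRing.Theory Num.Theory.
Local Open Scope ring_scope.

(* Locked, as conversion may try to evaluate finite-support functions. *)
HB.lock Definition mbasis (R : fieldType) (K : choiceType) (k : K) :
  {malg R[K]} := << k >>.

Arguments mbasis {R K} k.

Lemma mbasisE (R : fieldType) (K : choiceType) (k : K) :
  mbasis k = << k >> :> {malg R[K]}.
Proof. by rewrite unlock. Qed.

Lemma mbasis1 (R : fieldType) (K : monomType) : mbasis mone = 1 :> {malg R[K]}.
Proof. exact: mbasisE. Qed.

HB.lock Definition linext (R : fieldType) (K : choiceType) (V : lmodType R)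
    (g : K -> V) (x : {malg R[K]}) : V :=
  \sum_(k <- msupp x) x@_k *: g k.

Section LinearExtension.
Context {R : fieldType} {K : choiceType} {V : lmodType R}.
Implicit Types (g : K -> V) (x : {malg R[K]}).

Lemma linextE g x : linext g x = \sum_(k <- msupp x) x@_k *: g k.
Proof. by rewrite unlock. Qed.

Lemma linextEw g (D : {fset K}) (x : {malg R[K]}) : (msupp x `<=` D)%fset ->
  linext g x = \sum_(k <- D) x@_k *: g k.
Proof.
move=> sxD; rewrite linextE (big_fset_incl _ sxD) //= => k _ /mcoeff_outdom->.
by rewrite scale0r.
Qed.

Lemma linextU g k : linext g (mbasis k) = g k.
Proof.
by rewrite linextE mbasisE msuppU oner_eq0 big_seq_fset1 mcoeffUU scale1r.
Qed.

Lemma linext_is_linear g : linear (linext g).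
Proof.
move=> a x y; pose D := (msupp x `|` msupp y `|` msupp (a *: x + y))%fset.
have sx : (msupp x `<=` D)%fset by rewrite /D -fsetUA fsubsetUl.
have sy : (msupp y `<=` D)%fset by rewrite /D fsetUAC fsubsetUr.
rewrite (linextEw _ sx) (linextEw _ sy) (linextEw _ (fsubsetUr _ _) : _ = \sum_(k <- D) _).
rewrite scaler_sumr -big_split /=; apply: eq_bigr => k _.
by rewrite mcoeffD mcoeffZ scalerDl scalerA.
Qed.

HB.instance Definition _ g :=
  GRing.isLinear.Build R {malg R[K]} V *:%R (linext g) (linext_is_linear g).

End LinearExtension.

Section Truncation.
Variables (R : fieldType) (K : choiceType) (w : K -> nat) (N : nat).

Definition weight_le : {pred {malg R[K]}} :=
  fun x => all (fun k => (w k <= N)%N) (msupp x).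

Lemma weight_leP x :
  reflect (forall k, k \in msupp x -> (w k <= N)%N) (x \in weight_le).
Proof. exact: allP. Qed.

Lemma weight_le_submod : submod_closed weight_le.
Proof.
split; first by apply/weight_leP => k; rewrite msupp0.
move=> a x y /weight_leP hx /weight_leP hy; apply/weight_leP => k.
move/(fsubsetP (msuppD_le _ _)); rewrite in_fsetU => /orP[|/hy//].
by move/(fsubsetP (msuppZ_le _ _)) => /hx.
Qed.

HB.instance Definition _ :=
  GRing.isSubmodClosed.Build R {malg R[K]} weight_le weight_le_submod.

Record tmalg := TMalg { mval :> {malg R[K]}; _ : mval \in weight_le }.

HB.instance Definition _ := [isSub for mval].
HB.instance Definition _ := [Choice of tmalg by <:].
HB.instance Definition _ := [SubChoice_isSubLmodule of tmalg by <:].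

Lemma trunc_subproof (k : K) : (if (w k <= N)%N then mbasis k else 0) \in weight_le.
Proof.
case: ifP => hk; last exact: rpred0.
by apply/weight_leP => j; rewrite mbasisE msuppU oner_eq0 in_fset1 => /eqP->.
Qed.

Definition tbasis (k : K) : tmalg := TMalg (trunc_subproof k).

Definition truncate : {malg R[K]} -> tmalg := linext tbasis.

End Truncation.

Arguments tbasis {R K w N} k.
Arguments truncate {R K w N} x.

Definition lindual (R : fieldType) (U : lmodType R) := {linear U -> R^o}.

Section Dual.
Variables (R : fieldType) (U : lmodType R).
Implicit Types X Y Z : lindual U.

Lemma dualP X Y : (forall u, X u = Y u) -> X = Y.
Proof.
case: X Y => [f cf] [g cg] /= fg; have {}fg : f = g by apply: funext.
case: _ / fg cg => cg; congr GRing.Linear.Pack.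
case: cf cg => [a1 b1] [a2 b2].
congr GRing.Linear.Class; first by case: a1 a2 => p [q]; congr GRing.isNmodMorphism.Axioms_; apply: Prop_irrelevance.
by case: b1 b2 => p [q]; congr GRing.isScalable.Axioms_; apply: Prop_irrelevance.
Qed.

HB.instance Definition _ := gen_eqMixin (lindual U).
HB.instance Definition _ := gen_choiceMixin (lindual U).

Definition dual_zero : lindual U := \0.
Definition dual_opp X : lindual U := \- X.
Definition dual_add X Y : lindual U := X \+ Y.
Definition dual_scale (a : R) X : lindual U := a \*: X.

Lemma dual_addA : associative dual_add.
Proof. by move=> X Y Z; apply: dualP => u /=; rewrite addrA. Qed.
Lemma dual_addC : commutative dual_add.
Proof. by move=> X Y; apply: dualP => u /=; rewrite addrC. Qed.
Lemma dual_add0 : left_id dual_zero dual_add.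
Proof. by move=> X; apply: dualP => u /=; rewrite add0r. Qed.
Lemma dual_addN : left_inverse dual_zero dual_opp dual_add.
Proof. by move=> X; apply: dualP => u /=; rewrite addNr. Qed.

HB.instance Definition _ := GRing.isZmodule.Build (lindual U)
  dual_addA dual_addC dual_add0 dual_addN.

Lemma dual_scaleA a b X : dual_scale a (dual_scale b X) = dual_scale (a * b) X.
Proof. by apply: dualP => u /=; rewrite scalerA. Qed.
Lemma dual_scale1 : left_id 1 dual_scale.
Proof. by move=> X; apply: dualP => u /=; rewrite scale1r. Qed.
Lemma dual_scaleDr : right_distributive dual_scale +%R.
Proof. by move=> a X Y; apply: dualP => u /=; rewrite scalerDr. Qed.
Lemma dual_scaleDl X : {morph dual_scale^~ X : a b / a + b}.
Proof. by move=> a b; apply: dualP => u /=; rewrite scalerDl. Qed.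

HB.instance Definition _ := GRing.Zmodule_isLmodule.Build R (lindual U)
  dual_scaleA dual_scale1 dual_scaleDr dual_scaleDl.

Lemma dual0E u : (0 : lindual U) u = 0. Proof. by []. Qed.
Lemma dualDE X Y u : (X + Y) u = X u + Y u. Proof. by []. Qed.
Lemma dualZE (a : R) X u : (a *: X) u = a * X u. Proof. by []. Qed.

End Dual.


Section ProductMonoid.
Variables K1 K2 : monomType.
Implicit Types a b : (K1 * K2)%type.

Definition prod_mone : (K1 * K2)%type := (mone, mone).
Definition prod_mmul a b : (K1 * K2)%type :=
  (mmul a.1 b.1, mmul a.2 b.2).

Lemma prod_mmulA : associative prod_mmul.
Proof. by move=> a b c; rewrite /prod_mmul !mulmA. Qed.
Lemma prod_mul1m : left_id prod_mone prod_mmul.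
Proof. by case=> a b; rewrite /prod_mmul !mul1m. Qed.
Lemma prod_mulm1 : right_id prod_mone prod_mmul.
Proof. by case=> a b; rewrite /prod_mmul !mulm1. Qed.
Lemma prod_unitm a b : prod_mmul a b = prod_mone ->
  a = prod_mone /\ b = prod_mone.
Proof. by case: a b => [? ?] [? ?] [/unitm[-> ->] /unitm[-> ->]]. Qed.

HB.instance Definition _ := Choice_isMonomialDef.Build (K1 * K2)%type
  prod_mmulA prod_mul1m prod_mulm1 prod_unitm.

End ProductMonoid.

Lemma prod_mmulC (K1 K2 : conomType) : commutative (@prod_mmul K1 K2).
Proof. by move=> a b; rewrite /prod_mmul mulmC [in X in (_, X)]mulmC. Qed.

HB.instance Definition _ (K1 K2 : conomType) :=
  MonomialDef_isConomialDef.Build (K1 * K2)%type (@prod_mmulC K1 K2).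

Section Trees.
Variable d : nat.

Inductive ptree : Type := PNode of 'I_d.+1 & seq ptree.

Lemma ptree_ind_all (P : ptree -> Prop) :
  (forall i l, foldr (fun t Q => P t /\ Q) True l -> P (PNode i l)) ->
  forall t, P t.
Proof.
move=> IH; fix rec 1 => -[i l]; apply: IH.
by elim: l => [//|u l IHl] /=; split; [exact: rec | exact: IHl].
Qed.

Fixpoint ptree_encode (t : ptree) : GenTree.tree 'I_d.+1 :=
  let: PNode i l := t in GenTree.Node 0 (GenTree.Leaf i :: map ptree_encode l).

Fixpoint ptree_decode (g : GenTree.tree 'I_d.+1) : option ptree :=
  if g is GenTree.Node _ (GenTree.Leaf i :: l)
  then Some (PNode i (pmap ptree_decode l)) else None.

Lemma ptree_encodeK : pcancel ptree_encode ptree_decode.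
Proof.
elim/ptree_ind_all => i l IH /=; congr (Some (PNode i _)).
by elim: l IH => [//|u l IHl] /= [-> /IHl ->].
Qed.

HB.instance Definition _ := Countable.copy ptree (pcan_type ptree_encodeK).

Lemma ptree_ind_mem (P : ptree -> Prop) :
  (forall i l, {in l, forall t, P t} -> P (PNode i l)) -> forall t, P t.
Proof.
move=> IH; elim/ptree_ind_all => i l Pl; apply: IH => t.
by elim: l Pl => [//|u l IHl] /= [Pu /IHl{}IHl]; rewrite inE => /predU1P[->|/IHl].
Qed.

Definition ptree_le : rel ptree := relpre choice.pickle leq.

Lemma ptree_le_total : total ptree_le.
Proof. by move=> t u; exact: leq_total. Qed.
Lemma ptree_le_trans : transitive ptree_le.
Proof. by move=> t u v; exact: leq_trans. Qed.
Lemma ptree_le_anti : antisymmetric ptree_le.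
Proof. by move=> t u /anti_leq/(pcan_inj choice.pickleK). Qed.

(* A non-planar tree is represented by the planar tree in which the children of
   every node are listed in increasing order for an arbitrary total order;
   [root_graft], [children_graft] and [graft_root_children] below identify a
   tree with its root decoration and the multiset of its children. *)
Fixpoint canon (t : ptree) : ptree :=
  let: PNode i l := t in PNode i (sort ptree_le (map canon l)).

Lemma canonK : forall t, canon (canon t) = canon t.
Proof.
elim/ptree_ind_mem => i l IH /=; congr PNode.
have -> : map canon (sort ptree_le (map canon l)) = sort ptree_le (map canon l).
  rewrite -[RHS]map_id; apply/eq_in_map => t.
  by rewrite mem_sort => /mapP[u ul ->]; exact: IH.
exact/sorted_sort/sort_sorted/ptree_le_total/ptree_le_trans.
Qed.

Record tree := Tree { ptree_of :> ptree; _ : canon ptree_of == ptree_of }.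

HB.instance Definition _ := [isSub for ptree_of].
HB.instance Definition _ := [Countable of tree by <:].

Definition unplanar (t : ptree) : tree := Tree (introT eqP (canonK t)).

Lemma unplanarK : cancel ptree_of unplanar.
Proof. by move=> t; apply: val_inj => /=; exact/eqP/(valP t). Qed.

Local Notation forest := {cmonom tree}.

Definition forest_of_seq (s : seq tree) : forest :=
  \big[mmul/mone]_(t <- s) ucm t.

Definition forest_trees (f : forest) : seq tree :=
  flatten [seq nseq (f t) t | t <- finsupp f].

Definition graft (i : 'I_d.+1) (f : forest) : tree :=
  unplanar (PNode i (map ptree_of (forest_trees f))).

Definition tree_root (t : tree) : 'I_d.+1 := let: PNode i _ := ptree_of t in i.

Definition children (t : tree) : forest :=
  let: PNode _ l := ptree_of t in forest_of_seq (map unplanar l).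

Lemma perm_canon (l1 l2 : seq ptree) i : perm_eq (map canon l1) (map canon l2) ->
  canon (PNode i l1) = canon (PNode i l2).
Proof.
move=> l12 /=; congr PNode; apply/perm_sortP => //.
- exact: ptree_le_total.
- exact: ptree_le_trans.
- exact: ptree_le_anti.
Qed.

Lemma forest_of_seqE s t : forest_of_seq s t = count_mem t s.
Proof.
rewrite /forest_of_seq; elim: s => [|u s IH]; first by rewrite big_nil cm1.
by rewrite big_cons cmM IH cmU.
Qed.

Lemma forest_treesK f : forest_of_seq (forest_trees f) = f.
Proof.
apply/eqP/cmP => t; rewrite forest_of_seqE /forest_trees count_flatten -map_comp.
rewrite sumnE big_map; have [tf|tf] := boolP (t \in finsupp f).
  rewrite (big_fsetD1 t) //= count_nseq /= eqxx mul1n big1_fset ?addn0 // => u.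
  by rewrite in_fsetD1 count_nseq /= => /andP[/negPf -> _].
rewrite big1_fset => [|u uf _]; first by apply/esym/eqP; rewrite cmE_eq0.
by rewrite /= count_nseq /=; case: eqP uf tf => [->->|].
Qed.

Lemma root_graft i f : tree_root (graft i f) = i.
Proof. by []. Qed.

Lemma forest_of_seq_perm s1 s2 :
  reflect (forest_of_seq s1 = forest_of_seq s2) (perm_eq s1 s2).
Proof.
apply: (iffP idP) => [/permP e|e].
  by apply/eqP/cmP => t; rewrite !forest_of_seqE e.
by apply/allP => t _ /=; rewrite -!forest_of_seqE e.
Qed.

Lemma children_graft i f : children (graft i f) = f.
Proof.
rewrite -[RHS]forest_treesK /children /=; apply/forest_of_seq_perm.
rewrite (permPl (perm_map _ (permEl (perm_sort _ _)))) -!map_comp.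
rewrite (_ : map _ _ = forest_trees f) //; apply/map_id_in => t _ /=.
by apply: val_inj => /=; rewrite canonK; exact/eqP/(valP t).
Qed.

Lemma canon_root i l (t : tree) : ptree_of t = PNode i l ->
  {in l, forall u, canon u = u}.
Proof.
move=> e; have /eqP := valP t; rewrite /= e /= => -[el] u.
by rewrite -el mem_sort => /mapP[v _ ->]; rewrite canonK.
Qed.

Lemma graft_root_children t : graft (tree_root t) (children t) = t.
Proof.
apply: val_inj => /=; rewrite /tree_root /children.
case e: (ptree_of t) => [i l].
transitivity (canon (PNode i l)); last by rewrite -e; exact/eqP/(valP t).
apply: perm_canon; apply: perm_map.
have /(perm_map ptree_of)/permPl-> :
    perm_eq (forest_trees (forest_of_seq (map unplanar l))) (map unplanar l).
  by apply/forest_of_seq_perm; rewrite forest_treesK.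
rewrite -map_comp map_id_in // => u ul /=; exact: canon_root e u ul.
Qed.

Fixpoint ptree_nodes (p : pred 'I_d.+1) (t : ptree) : nat :=
  let: PNode i l := t in (p i + sumn (map (ptree_nodes p) l))%N.

Definition tree_size (t : tree) : nat := ptree_nodes predT t.

Definition tree_size0 (t : tree) : nat := ptree_nodes (pred1 ord0) t.

Definition forest_size (f : forest) : nat :=
  (\sum_(t <- forest_trees f) tree_size t)%N.

End Trees.

Notation forest d := {cmonom (tree d)}.

Section Coproduct.
Variables (R : fieldType) (d : nat).

Local Notation H := {malg R[forest d]}.
Local Notation HH := {malg R[(forest d * forest d)%type]}.

Implicit Types (f h : forest d) (x y : H).

Definition tensor x y : HH :=
  linext (fun f => linext (fun h => mbasis (f, h)) y) x.

Definition Bplus i : H -> H := linext (fun f => mbasis (ucm (graft i f))).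

Definition Bplus_id i : HH -> HH :=
  linext (fun fh => mbasis (ucm (graft i fh.1), fh.2)).

Fixpoint ptree_coproduct (t : ptree d) : HH :=
  let: PNode i l := t in
  mbasis (mone, ucm (unplanar (PNode i l)))
  + Bplus_id i (foldr (fun u z => ptree_coproduct u * z) 1 l).

Definition forest_coproduct (f : forest d) : HH :=
  \prod_(t <- forest_trees f) ptree_coproduct t.

Definition coproduct : H -> HH := linext forest_coproduct.

HB.instance Definition _ := GRing.Linear.on coproduct.
HB.instance Definition _ i := GRing.Linear.on (Bplus i).
HB.instance Definition _ i := GRing.Linear.on (Bplus_id i).

Lemma tensorU f h : tensor (mbasis f) (mbasis h) = mbasis (f, h).
Proof.
by rewrite /tensor !linextU.
Qed.

Lemma coproduct1 : coproduct 1 = tensor 1 1.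
Proof.
rewrite -mbasis1 tensorU /coproduct linextU /forest_coproduct.
by rewrite /forest_trees mdom1 big_nil -mbasis1.
Qed.

Lemma forest_treesM f h :
  perm_eq (forest_trees (mmul f h)) (forest_trees f ++ forest_trees h).
Proof.
apply/forest_of_seq_perm; rewrite forest_treesK /forest_of_seq big_cat /=.
by rewrite -!/(forest_of_seq _) !forest_treesK.
Qed.

Lemma linextM (A : comAlgType R) (K : conomType) (g : K -> A) :
  {morph g : a b / mmul a b >-> a * b} -> {morph linext g : x y / x * y}.
Proof.
move=> gM x y; rewrite {1}malgME raddf_sum [X in X * _]linextE mulr_suml.
apply: eq_bigr => a _; rewrite raddf_sum /= [X in _ * X]linextE mulr_sumr; apply: eq_bigr => b _.
rewrite -[<< _ *g _ >>](_ : (x@_a * y@_b) *: mbasis (mmul a b) = _); last first.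
  by apply/malgP => k; rewrite mbasisE mcoeffZ !mcoeffU mulr_natr.
by rewrite linearZ /= linextU gM -scalerAl -scalerAr scalerA.
Qed.

Lemma coproductM : {morph coproduct : x y / x * y}.
Proof.
apply: linextM => f h; rewrite /forest_coproduct.
by rewrite (perm_big _ (forest_treesM f h)) big_cat.
Qed.

Lemma BplusU i f : Bplus i (mbasis f) = mbasis (ucm (graft i f)).
Proof. exact: linextU. Qed.

Lemma coproductU f : coproduct (mbasis f) = forest_coproduct f.
Proof. exact: linextU. Qed.

Lemma forest_trees_ucm (t : tree d) : forest_trees (ucm t) = [:: t].
Proof.
apply: perm_small_eq => //; apply/forest_of_seq_perm.
by rewrite forest_treesK /forest_of_seq big_seq1.
Qed.

Lemma coproduct_Bplus i f :
  coproduct (Bplus i (mbasis f))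
  = tensor 1 (Bplus i (mbasis f)) + Bplus_id i (coproduct (mbasis f)).
Proof.
rewrite -mbasis1 BplusU !coproductU tensorU {1}/forest_coproduct forest_trees_ucm.
rewrite big_seq1; set g := graft i f.
have -> : ptree_of g = PNode i (sort (@ptree_le d)
    (map (@canon d) (map (@ptree_of d) (forest_trees f)))) by [].
set l := sort _ _; rewrite [LHS]/=.
have -> : unplanar (PNode i l) = g by rewrite -[RHS]unplanarK.
congr (_ + Bplus_id i _).
have -> s : foldr (fun u z => ptree_coproduct u * z) 1 s
    = \prod_(u <- s) ptree_coproduct u.
  by elim: s => [|u s IH]; rewrite ?big_nil // big_cons /= IH.
rewrite (perm_big _ (permEl (perm_sort _ _))) -map_comp big_map /=.
by apply: eq_bigr => t _; rewrite (eqP (valP t)).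
Qed.

End Coproduct.

Notation HN R d N := (tmalg R (@forest_size d) N).
Notation HNdual R d N := (lindual (HN R d N)).

Section DualAlgebra.
Variables (R : fieldType) (d N : nat).

Local Notation H := {malg R[forest d]}.
Local Notation HH := {malg R[(forest d * forest d)%type]}.
Local Notation A := (HN R d N).
Local Notation A' := (HNdual R d N).

Implicit Types (X Y : A') (M : {linear A -> A}).

(* On pairs of forests with at most [N] nodes each this is [X (x) Y]; the value
   on the other pairs, which do not occur in [coproduct x] for [x : HN], is 0. *)
Definition tensor_form X Y : HH -> R^o :=
  linext (fun fh => X (tbasis fh.1) * Y (tbasis fh.2) : R^o).

HB.instance Definition _ X Y := GRing.Linear.on (tensor_form X Y).

Definition convolution X Y : A' := tensor_form X Y \o (coproduct (d := d) \o val).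

Definition tensor_map M : HH -> HH :=
  linext (fun fh => tensor (M (tbasis fh.1)) (M (tbasis fh.2))).

Definition coord (f : forest d) (x : A) : R^o := (x : H)@_f.

Lemma coord_is_linear f : linear (coord f).
Proof. by move=> a x y; rewrite /coord /= mcoeffD mcoeffZ. Qed.

HB.instance Definition _ f :=
  GRing.isLinear.Build R A R^o *:%R (coord f) (coord_is_linear f).

Definition forest_form (f : forest d) : A' := coord f.

Definition unit_form : A' := forest_form mone.

(* A linear combination of forests seen as an element of the dual; forests with
   more than [N] nodes are sent to 0. *)
Definition to_dual : H -> A' := linext forest_form.

Definition adjoint M X : A' := X \o M.

(* The last clause covers exactly the products that lie in [HN]. *)
Definition character X : Prop :=
  X (tbasis mone) = 1 /\
  forall f h k : A, (k : H) = (f : H) * (h : H) -> X k = X f * X h.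

End DualAlgebra.

Definition word_size (sz : nat -> nat) (r : {fmonom nat}) : nat :=
  (\sum_(i <- r) sz i)%N.

(* The letter [i] stands for the basis element [tau i], and [sz i] for its
   number of nodes (basis elements are numbered from 0); the product of
   [{malg R[{fmonom nat}]}] is concatenation. *)
Notation TN R sz N := (tmalg R (word_size sz) N).

Definition word_mul (R : fieldType) (sz : nat -> nat) (N : nat)
  (u v : TN R sz N) : TN R sz N := truncate (mval u * mval v).

Definition letter (i : nat) : {fmonom nat} := fmu i.

Section Basis.
Variables (R : fieldType) (d N : nat).

Definition word_form (tau : nat -> {malg R[forest d]}) (r : {fmonom nat}) :
    HNdual R d N :=
  \big[@convolution R d N/unit_form R d N]_(i <- r) to_dual N (tau i).

(* In [FC_words], the coordinates of [c : TN R sz N] are the [lambda_R]. *)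
Record Foissy_Chapoton_basis (tau : nat -> {malg R[forest d]})
    (sz sz0 : nat -> nat) : Prop := {
  FC_trees : forall i f, f \in msupp (tau i) ->
    exists t : tree d, [/\ f = ucm t, tree_size t = sz i & tree_size0 t = sz0 i];
  FC_free : forall c : {malg R[nat]}, linext tau c = 0 -> c = 0;
  FC_sorted : forall i j, (i <= j)%N -> (sz i <= sz j)%N;
  FC_words : forall Y : HNdual R d N,
    exists! c : TN R sz N, Y = linext (word_form tau) c
}.

End Basis.

Section RoughPaths.
Variables (R : realType) (d : nat).

Definition tree_weight (gamma : R) (t : tree d) : R :=
  (1 - gamma) * (tree_size0 t)%:R + gamma * (tree_size t)%:R.

Record branched_rough_path (gamma : R) (N : nat) (X : R -> R -> HNdual R d N) :
    Prop := {
  brp_character : forall s t, 0 <= s <= 1 -> 0 <= t <= 1 -> character (X s t);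
  brp_diag : forall t, 0 <= t <= 1 -> X t t = unit_form R d N;
  brp_chen : forall s u t, 0 <= s <= 1 -> 0 <= u <= 1 -> 0 <= t <= 1 ->
    convolution (X s u) (X u t) = X s t;
  brp_holder : forall tr : tree d, (tree_size tr <= N)%N ->
    exists C : R, forall s t, 0 <= s <= 1 -> 0 <= t <= 1 ->
      `|X s t (tbasis (ucm tr))| <= C * powR `|t - s| (tree_weight gamma tr)
}.

End RoughPaths.

(* Main.v *)
Require Import Defs.
From HB Require Import structures.
From mathcomp Require Import all_boot all_order all_algebra finmap.
From mathcomp Require Import monalg.
From mathcomp Require Import boolp reals exp.

Set Implicit Arguments.
Unset Strict Implicit.
Unset Printing Implicit Defensive.

Import Order.TTheory GRing.Theory Num.Theory.
Local Open Scope ring_scope.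

(* Dually to Delta, the convolution is associative with unit [1^*] and graded by
   the number of nodes, so the linear map [Psi] turns convolution into
   truncated concatenation: on basis words both sides are words in the [tau i],
   and both vanish when the total size exceeds [N].  As [M] commutes with Delta and
   preserves the counit, [adjoint M] is an endomorphism of the convolution
   algebra.  Hence [Psi \o adjoint M] and [Mt \o Psi] are unital, multiplicative
   and agree on the letters, so they agree on all words, which span the dual. *)

(** * Linear extensions of maps given on a basis *)

Section LinearExtensionTheory.
Context {R : fieldType} {K : choiceType}.
Implicit Types x y : {malg R[K]}.

Lemma eq_linext (V : lmodType R) (g h : K -> V) x :
  {in msupp x, g =1 h} -> linext g x = linext h x.
Proof.
by move=> gh; rewrite !linextE; apply: eq_big_seq => k /gh ->.
Qed.

Lemma linear_linext (V W : lmodType R) (L : {linear V -> W}) (g : K -> V) x :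
  L (linext g x) = linext (fun k => L (g k)) x.
Proof.
by rewrite !linextE linear_sum; apply: eq_bigr => k _; rewrite linearZ.
Qed.

Lemma linext_mbasis x : linext mbasis x = x.
Proof.
rewrite linextE [RHS]monalgE; apply: eq_bigr => k _; rewrite mbasisE.
by apply/malgP => j; rewrite mcoeffZ !mcoeffU mulr_natr.
Qed.

Lemma linext_mulr (A : lalgType R) (g : K -> A) c x :
  linext g x * c = linext (fun k => g k * c) x.
Proof.
by rewrite !linextE mulr_suml; apply: eq_bigr => k _; rewrite scalerAl.
Qed.

Lemma linext_mull (A : algType R) (g : K -> A) c x :
  c * linext g x = linext (fun k => c * g k) x.
Proof.
by rewrite !linextE mulr_sumr; apply: eq_bigr => k _; rewrite scalerAr.
Qed.

Lemma msupp_linext (K' : choiceType) (g : K -> {malg R[K']}) x k :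
  k \in msupp (linext g x) -> exists2 j, j \in msupp x & k \in msupp (g j).
Proof.
rewrite linextE -mcoeff_neq0 => nz; apply: contrapT => no.
case/eqP: nz; rewrite raddf_sum big1_seq // => j /= jx.
rewrite mcoeffZ (@mcoeff_outdom _ _ (g j)) ?mulr0 //.
by apply/negP => kj; apply: no; exists j.
Qed.

End LinearExtensionTheory.

(** * Products in monoid algebras *)

Section MonoidAlgebra.
Variables (R : fieldType).

Lemma malgM_linext (K : monomType) (x y : {malg R[K]}) :
  x * y = linext (fun a => linext (fun b => mbasis (mmul a b)) y) x.
Proof.
rewrite malgME linextE; apply: eq_bigr => a _.
rewrite linextE scaler_sumr; apply: eq_bigr => b _; rewrite mbasisE.
by apply/malgP => k; rewrite !mcoeffZ !mcoeffU mulrA mulr_natr.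
Qed.

Lemma mbasisM (K : monomType) (a b : K) :
  mbasis (mmul a b) = mbasis a * mbasis b :> {malg R[K]}.
Proof. by rewrite malgM_linext !linextU. Qed.

(** Three maps are allowed because, in [coproduct_idM] and [id_coproductM], each of them carries its
    own fixed tensor factor. *)
Lemma linextM_gen (K : monomType) (A : algType R) (g1 g2 g3 : K -> A) :
  (forall a b, g3 (mmul a b) = g1 a * g2 b) ->
  forall x y, linext g3 (x * y) = linext g1 x * linext g2 y.
Proof.
move=> gM x y; rewrite malgM_linext linear_linext linext_mulr.
apply: eq_linext => a _; rewrite linear_linext linext_mull.
by apply: eq_linext => b _; rewrite /= linextU gM.
Qed.

Lemma msupp_mbasis (K : choiceType) (k : K) :
  msupp (mbasis k : {malg R[K]}) = [fset k]%fset.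
Proof. by rewrite mbasisE msuppU oner_eq0. Qed.

End MonoidAlgebra.

(** * Induction on forests and their number of nodes *)

Section ForestTheory.
Variable d : nat.

(** A forest is a product of trees, and a tree is $B_+^i$ of the forest of its children. The cases
    match the recursive description of $\Delta$. *)
Lemma forest_ind (P : forest d -> Prop) :
  P mone -> (forall f h, P f -> P h -> P (mmul f h)) ->
  (forall i f, P f -> P (ucm (graft i f))) -> forall f, P f.
Proof.
move=> P1 PM PB.
have Ps (s : seq (tree d)) : {in s, forall t, P (ucm t)} -> P (forest_of_seq s).
  rewrite /forest_of_seq; elim: s => [|t s IH] Pt; first by rewrite big_nil.
  rewrite big_cons; apply: PM; first by apply: Pt; rewrite mem_head.
  by apply: IH => u us; apply: Pt; rewrite inE us orbT.
(* Trees have no structural recursion of their own, so the induction runs on the planar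
   representative; its subtrees are again canonical by [canon_root]. *)
have Pt : forall (p : ptree d) (t : tree d), ptree_of t = p -> P (ucm t).
  elim/ptree_ind_mem => i l IH t tE.
  rewrite -(graft_root_children t); apply: PB.
  rewrite /children tE; apply: Ps => u /mapP[v vl ->].
  by apply: (IH v vl) => /=; exact: canon_root tE v vl.
by move=> f; rewrite -(forest_treesK f); apply: Ps => t _; exact: Pt (erefl _).
Qed.

Lemma forest_size1 : @forest_size d mone = 0%N.
Proof. by rewrite /forest_size /forest_trees mdom1 big_nil. Qed.

Lemma forest_sizeM (f h : forest d) :
  forest_size (mmul f h) = (forest_size f + forest_size h)%N.
Proof. by rewrite /forest_size (perm_big _ (forest_treesM f h)) big_cat. Qed.

Lemma forest_sizeU (t : tree d) : forest_size (ucm t) = tree_size t.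
Proof. by rewrite /forest_size forest_trees_ucm big_seq1. Qed.

Lemma ptree_nodes_canon (p : pred 'I_d.+1) (t : ptree d) :
  ptree_nodes p (Defs.canon t) = ptree_nodes p t.
Proof.
move: t; elim/ptree_ind_mem => i l IH /=; congr (_ + _)%N.
rewrite !sumnE !big_map (perm_big _ (permEl (perm_sort _ _))) big_map.
by apply: eq_big_seq => u /IH.
Qed.

Lemma forest_size_graft i (f : forest d) :
  forest_size (ucm (graft i f)) = (forest_size f).+1.
Proof.
rewrite forest_sizeU /tree_size /graft /unplanar [ptree_of _]/=.
by rewrite -/(Defs.canon (PNode i _)) ptree_nodes_canon /= add1n sumnE !big_map.
Qed.

End ForestTheory.

(** * Grading, coassociativity and counit of $\Delta$ *)

Section CoproductTheory.
Variables (R : fieldType) (d : nat).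
Local Notation F := (forest d).
Local Notation H := {malg R[F]}.
Local Notation HH := {malg R[(F * F)%type]}.
Local Notation HHH := {malg R[(F * F * F)%type]}.
Local Notation D := (@forest_coproduct R d).

Lemma forest_coproduct1 : D mone = 1.
Proof. by rewrite /forest_coproduct /forest_trees mdom1 big_nil. Qed.

Lemma forest_coproductM f h : D (mmul f h) = D f * D h.
Proof. by rewrite -!coproductU mbasisM coproductM. Qed.

Lemma forest_coproduct_graft i f :
  D (ucm (graft i f)) = mbasis (mone, ucm (graft i f)) + Bplus_id i (D f).
Proof.
by rewrite -!coproductU -BplusU coproduct_Bplus BplusU -mbasis1 tensorU.
Qed.

(** In the recursion for $\Delta B_+^i(f)$, the term $1\otimes B_+^i(f)$ is clear, and
    $B_+^i\otimes\mathrm{id}$ adds one node to the left factor. This grading makes $\Delta$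
    compatible with truncation at $N$. *)
Lemma forest_coproduct_size f a b : (a, b) \in msupp (D f) ->
  (forest_size a + forest_size b)%N = forest_size f.
Proof.
elim/forest_ind: f a b => [|f h IHf IHh|i f IH] a b.
- rewrite forest_coproduct1 -mbasis1 msupp_mbasis in_fset1 => /eqP[-> ->].
  by rewrite forest_size1.
- rewrite forest_coproductM => /msuppM_le[[a1 b1]] [[a2 b2]] [/IHf e1 /IHh e2].
  by case=> -> ->; rewrite !forest_sizeM -e1 -e2 addnACA.
- rewrite forest_coproduct_graft => /(fsubsetP (msuppD_le _ _)).
  rewrite in_fsetU msupp_mbasis in_fset1 => /orP[/eqP[-> ->]|].
    by rewrite forest_size1.
  case/msupp_linext => -[a' b'] /IH e.
  rewrite msupp_mbasis in_fset1 => /eqP[-> ->].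
  by rewrite !forest_size_graft addSn e.
Qed.

(** The map $\Delta\otimes\mathrm{id}$, followed below by $\mathrm{id}\otimes\Delta$; both take
    values on triples nested to the left. *)
Definition coproduct_id : HH -> HHH :=
  linext (fun fh => linext (fun ab => mbasis (ab, fh.2)) (D fh.1)).

Definition id_coproduct : HH -> HHH :=
  linext (fun fh => linext (fun ab => mbasis (fh.1, ab.1, ab.2)) (D fh.2)).

HB.instance Definition _ := GRing.Linear.on coproduct_id.
HB.instance Definition _ := GRing.Linear.on id_coproduct.

Lemma coproduct_idM : {morph coproduct_id : x y / x * y}.
Proof.
apply: linextM => -[a b] [a' b'] /=; rewrite forest_coproductM.
by apply: linextM_gen => u v; rewrite -mbasisM.
Qed.

Lemma id_coproductM : {morph id_coproduct : x y / x * y}.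
Proof.
apply: linextM => -[a b] [a' b'] /=; rewrite forest_coproductM.
by apply: linextM_gen => u v; rewrite -mbasisM.
Qed.

(** Both sides are multiplicative in [f], so only grafting needs work; there the recursion for
    $\Delta B_+^i$ is applied on either side. *)
Lemma coproductA f : coproduct_id (D f) = id_coproduct (D f).
Proof.
elim/forest_ind: f => [|f h IHf IHh|i f IH].
- rewrite forest_coproduct1 -mbasis1 /coproduct_id /id_coproduct !linextU /=.
  by rewrite forest_coproduct1 -mbasis1 !linextU.
- by rewrite forest_coproductM coproduct_idM id_coproductM IHf IHh.
(* [B3] is $B_+^i\otimes\mathrm{id}\otimes\mathrm{id}$, and [e1] is $z\mapsto 1\otimes z$. *)
pose B3 : HHH -> HHH :=
  linext (fun k => mbasis (ucm (graft i k.1.1), k.1.2, k.2)).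
pose e1 : HH -> HHH := linext (fun k => mbasis (mone, k.1, k.2)).
have DB z :
    coproduct_id (Bplus_id i z) = e1 (Bplus_id i z) + B3 (coproduct_id z).
  rewrite /coproduct_id /Bplus_id /e1 /B3 !linear_linext /= !linextE -big_split.
  apply: eq_bigr => -[a b] _ /=; rewrite -scalerDr !linextU /=; congr (_ *: _).
  rewrite forest_coproduct_graft linearD /= linextU /=; congr (_ + _).
  rewrite /Bplus_id !linear_linext /=; apply: eq_linext => -[a' b'] _.
  by rewrite !linextU.
have DB' z : id_coproduct (Bplus_id i z) = B3 (id_coproduct z).
  rewrite /id_coproduct /Bplus_id /B3 !linear_linext /=.
  apply: eq_linext => -[a b] _; rewrite /= linextU linear_linext /=.
  by apply: eq_linext => -[a' b'] _; rewrite linextU.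
(* The [B3] terms agree by induction. What remains is $1\otimes1\otimes
   B_+^i(f)+1\otimes(B_+^i\otimes\mathrm{id})\Delta f=1\otimes\Delta B_+^i(f)$. *)
rewrite {1}forest_coproduct_graft linearD /= DB IH -DB' addrA.
rewrite [in RHS]forest_coproduct_graft linearD /=; congr (_ + _).
rewrite {1}/coproduct_id {1}/id_coproduct !linextU /= forest_coproduct1.
by rewrite -mbasis1 linextU forest_coproduct_graft /e1 linearD /= linextU.
Qed.

(** For a grafted tree, every term other than $1\otimes B_+^i(f)$ has the new root in its left
    factor, which is therefore not the empty forest. *)
Lemma coproduct_counit f :
  linext (fun ab : F * F => (ab.1 == mone)%:R *: mbasis ab.2) (D f)
  = mbasis f :> H.
Proof.
elim/forest_ind: f => [|f h IHf IHh|i f IH].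
- by rewrite forest_coproduct1 -mbasis1 linextU /= eqxx scale1r.
- rewrite forest_coproductM mbasisM -IHf -IHh.
  apply: linextM_gen => -[a b] [a' b'] /=.
  by rewrite cmM_eq1 mbasisM -scalerAl -scalerAr scalerA -natrM mulnb.
- rewrite forest_coproduct_graft linearD /= linextU /= eqxx scale1r.
  rewrite /Bplus_id linear_linext (eq_linext (h := fun=> 0)) => [|[a b] _].
    by rewrite linextE big1 ?addr0 // => k _; rewrite scaler0.
  by rewrite /= linextU cm1_eq1 scale0r.
Qed.

End CoproductTheory.

(** * Truncated spaces and their bases *)

Section TruncationTheory.
Variables (R : fieldType) (K : choiceType) (w : K -> nat) (N : nat).
Local Notation A := (tmalg R w N).

Lemma mval_tbasis k : (w k <= N)%N -> mval (tbasis k : A) = mbasis k.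
Proof. by move=> /= ->. Qed.

Lemma tbasis_gt k : (N < w k)%N -> tbasis k = 0 :> A.
Proof. by move=> kN; apply: val_inj; rewrite /= leqNgt kN. Qed.

Lemma linext_tbasis (x : A) : linext tbasis (mval x) = x.
Proof.
apply: val_inj; rewrite linear_linext -[RHS]linext_mbasis.
apply: eq_linext => k /(weight_leP _ _ _ (valP x)) kN.
exact: mval_tbasis kN.
Qed.

Lemma linear_tmalgE (V : lmodType R) (L : {linear A -> V}) x :
  L x = linext (fun k => L (tbasis k)) (mval x).
Proof. by rewrite -linear_linext linext_tbasis. Qed.

End TruncationTheory.

(** * The convolution algebra on the dual and its grading *)

Section ConvolutionTheory.
Variables (R : fieldType) (d N : nat).
Local Notation A := (HN R d N).
Local Notation A' := (HNdual R d N).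
Implicit Types X Y Z : A'.

Lemma dual_ext X Y :
  (forall f, (forest_size f <= N)%N -> X (tbasis f) = Y (tbasis f)) -> X = Y.
Proof.
move=> XY; apply: dualP => x; rewrite (linear_tmalgE X) (linear_tmalgE Y).
by apply: eq_linext => f /(weight_leP _ _ _ (valP x)) /XY.
Qed.

Lemma convolution_tbasis X Y f : (forest_size f <= N)%N ->
  convolution X Y (tbasis f) = tensor_form X Y (forest_coproduct R f).
Proof. by move=> fN; rewrite /convolution /= fN coproductU. Qed.

(** The arguments are swapped so that linearity in the left factor can be registered. *)
Definition convolution_left Y X : A' := convolution X Y.

Lemma convolution_left_linear Y : linear (convolution_left Y).
Proof.
move=> a X X'; apply: dualP => x.
transitivity (a * convolution X Y x + convolution X' Y x); last by [].
rewrite /convolution_left /convolution /= /tensor_form !linextE.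
rewrite mulr_sumr -big_split; apply: eq_bigr => k _ /=.
by rewrite mulrDl scalerDr -scalerAl scalerA [_ * a]mulrC -scalerA.
Qed.

Lemma convolution_linear X : linear (convolution X).
Proof.
move=> a Y Y'; apply: dualP => x.
transitivity (a * convolution X Y x + convolution X Y' x); last by [].
rewrite /convolution /= /tensor_form !linextE.
rewrite mulr_sumr -big_split; apply: eq_bigr => k _ /=.
by rewrite mulrDr scalerDr -scalerAr scalerA [_ * a]mulrC -scalerA.
Qed.

HB.instance Definition _ Y := GRing.isLinear.Build R A' A' *:%R
  (convolution_left Y) (convolution_left_linear Y).
HB.instance Definition _ X := GRing.isLinear.Build R A' A' *:%R
  (convolution X) (convolution_linear X).

Lemma convolution_linext (K1 K2 : choiceType) (g : K1 -> A') (h : K2 -> A')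
    x y :
  convolution (linext g x) (linext h y)
  = linext (fun a => linext (fun b => convolution (g a) (h b)) y) x.
Proof.
rewrite -/(convolution_left _ _) linear_linext; apply: eq_linext => a _.
by rewrite /= /convolution_left linear_linext.
Qed.

(** Both sides are $X\otimes Y\otimes Z$ (the map [T]) applied to the twofold coproduct of [f], so
    coassociativity concludes. *)
Lemma convolutionA : associative (@convolution R d N).
Proof.
move=> X Y Z; apply: dual_ext => f fN; rewrite !convolution_tbasis //.
pose T := linext (fun k : forest d * forest d * forest d =>
  X (tbasis k.1.1) * Y (tbasis k.1.2) * Z (tbasis k.2) : R^o).
transitivity (T (id_coproduct (forest_coproduct R f))).
  rewrite /T /id_coproduct linear_linext; apply: eq_linext => -[a b] ab.
  lazy beta; rewrite [fst _]/= [snd _]/=.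
  (* The grading of $\Delta$ keeps the factors within $N$ nodes, where the inner convolution is
     given by the coproduct and not by the value 0. *)
  have bN : (forest_size b <= N)%N.
    by apply: leq_trans fN; rewrite -(forest_coproduct_size ab) leq_addl.
  rewrite convolution_tbasis // /tensor_form (linext_mull (A := R^o)).
  rewrite linear_linext.
  by apply: eq_linext => -[a' b'] _; rewrite /= linextU /= mulrA.
rewrite -coproductA /T /coproduct_id linear_linext.
apply: eq_linext => -[a b] ab; lazy beta; rewrite [fst _]/= [snd _]/=.
have aN : (forest_size a <= N)%N.
  by apply: leq_trans fN; rewrite -(forest_coproduct_size ab) leq_addr.
rewrite convolution_tbasis // /tensor_form (linext_mulr (A := R^o)).
rewrite linear_linext.
by apply: eq_linext => -[a' b'] _; rewrite /= linextU.
Qed.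

Lemma unit_form_tbasis f : unit_form R d N (tbasis f) = (f == mone)%:R.
Proof.
rewrite /unit_form /forest_form /= /Defs.coord /=.
case: ifP => [_|]; first by rewrite mbasisE mcoeffU1.
(* Beyond $N$ nodes [tbasis f] is 0, and [f] cannot be the empty forest, which has no nodes. *)
by rewrite mcoeff0; case: eqP => // ->; rewrite forest_size1.
Qed.

Lemma convolution1l : left_id (unit_form R d N) (@convolution R d N).
Proof.
move=> Y; apply: dual_ext => f fN; rewrite convolution_tbasis //.
transitivity (linext (fun h => Y (tbasis h)) (mbasis f : {malg R[forest d]})).
  rewrite -coproduct_counit linear_linext; apply: eq_linext => -[a b] _ /=.
  by rewrite linearZ /= linextU unit_form_tbasis.
by rewrite linextU.
Qed.

(** The degree-[n] part of the dual. As [tbasis f] is 0 for larger forests, the condition bears only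
    on forests with at most $N$ nodes. *)
Definition homogeneous n X :=
  forall f, forest_size f != n -> X (tbasis f) = 0.

(** If the sizes of [a] and [b] do not add up to $n+m$, then [X] vanishes on [a] or [Y] vanishes on
    [b]. *)
Lemma homogeneous_convolution n m X Y :
  homogeneous n X -> homogeneous m Y -> homogeneous (n + m) (convolution X Y).
Proof.
move=> Xn Ym f fnm; case: (leqP (forest_size f) N) => fN; last first.
  by rewrite tbasis_gt // linear0.
rewrite convolution_tbasis // /tensor_form.
rewrite (eq_linext (h := fun=> 0)) => [|[a b] /forest_coproduct_size ab /=].
  by rewrite linextE big1 // => k _; rewrite scaler0.
have [an|/Xn ->] := eqVneq (forest_size a) n; last by rewrite mul0r.
by rewrite (Ym b) ?mulr0 //; apply: contraNneq fnm => <-; rewrite -ab an.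
Qed.

Lemma homogeneous_unit : homogeneous 0 (unit_form R d N).
Proof.
move=> f f0; rewrite unit_form_tbasis.
by have [e|//] := eqVneq f mone; rewrite e forest_size1 in f0.
Qed.

Lemma homogeneous_gt n X : (N < n)%N -> homogeneous n X -> X = 0.
Proof.
move=> nN Xn; apply: dual_ext => f fN; rewrite Xn //.
by apply: contraTneq nN => <-; rewrite -leqNgt.
Qed.

Lemma to_dual_tbasis (x : {malg R[forest d]}) f : (forest_size f <= N)%N ->
  to_dual N x (tbasis f) = x@_f.
Proof.
move=> fN; have ev_lin : linear (fun X : A' => X (tbasis f) : R^o) by [].
(* Evaluation at [tbasis f] is packed as a linear map so that it can be moved inside [linext]. *)
pose ev : {linear A' -> R^o} :=
  HB.pack (fun X : A' => X (tbasis f)) (GRing.isLinear.Build _ _ _ _ _ ev_lin).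
rewrite -[LHS]/(ev _) /to_dual linear_linext linextE.
rewrite [in RHS](monalgE x) raddf_sum.
apply: eq_bigr => h _; rewrite /ev /= /Defs.coord /= fN mbasisE !mcoeffU eq_sym.
exact: mulr_natr.
Qed.

Lemma homogeneous_to_dual n (x : {malg R[forest d]}) :
  {in msupp x, forall f, forest_size f = n} -> homogeneous n (to_dual N x).
Proof.
move=> xn f fn; case: (leqP (forest_size f) N) => fN; last first.
  by rewrite tbasis_gt // linear0.
rewrite to_dual_tbasis // mcoeff_outdom //.
by apply: contra_neqN fn => /xn.
Qed.

End ConvolutionTheory.

(** * The adjoint of $M$ as an endomorphism of the convolution algebra *)

Section Adjoint.
Variables (R : fieldType) (d N : nat) (M : {linear HN R d N -> HN R d N}).
Implicit Types X Y : HNdual R d N.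

(** $(X\otimes Y)\Delta M=(X\otimes Y)(M\otimes M)\Delta=(X\circ M\otimes Y\circ M)\Delta$. *)
Lemma adjoint_convolution X Y :
  (forall x : HN R d N,
    tensor_map M (coproduct (mval x)) = coproduct (mval (M x))) ->
  adjoint M (convolution X Y) = convolution (adjoint M X) (adjoint M Y).
Proof.
move=> MD; apply: dualP => x; rewrite /adjoint /convolution /= -MD.
rewrite /tensor_form /tensor_map linear_linext; apply: eq_linext => -[a b] _ /=.
rewrite /tensor linear_linext (linear_tmalgE X) (linext_mulr (A := R^o)).
apply: eq_linext => f _; rewrite /= linear_linext (linear_tmalgE Y).
rewrite (linext_mull (A := R^o)); apply: eq_linext => h _.
by rewrite /= linextU.
Qed.

(** The form $\mathbf 1^*$ reads the coefficient of the empty forest, which is multiplicative. By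
    multiplicativity of $M$ it suffices to treat trees, whose images contain no empty forest. *)
Lemma adjoint_unit : M (tbasis mone) = tbasis mone ->
  (forall f h k : HN R d N,
    mval k = mval f * mval h -> mval (M k) = mval (M f) * mval (M h)) ->
  (forall t, (tree_size t <= N)%N ->
    mone \notin msupp (mval (M (tbasis (ucm t))))) ->
  adjoint M (unit_form R d N) = unit_form R d N.
Proof.
move=> M1 MM Mt; apply: dual_ext => f; rewrite unit_form_tbasis.
rewrite /adjoint /unit_form /forest_form /= /Defs.coord.
elim/forest_ind: f => [|f h IHf IHh|i f _].
- by rewrite M1 mval_tbasis ?forest_size1 // mbasisE mcoeffU1.
- rewrite forest_sizeM => fhN.
  have fN := leq_trans (leq_addr _ _) fhN.
  have hN := leq_trans (leq_addl _ _) fhN.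
  rewrite (MM (tbasis f) (tbasis h)); last first.
    by rewrite !mval_tbasis ?forest_sizeM // mbasisM.
  by rewrite rmorphM /= IHf // IHh // cmM_eq1 -natrM mulnb.
- by rewrite forest_sizeU => /Mt /mcoeff_outdom ->; rewrite cm1_eq1.
Qed.

End Adjoint.

(** * Words in the letters [tau i] and multiplicativity of [Psi] *)

Section Words.
Variables (R : fieldType) (d N : nat).
Variables (tau : nat -> {malg R[forest d]}) (sz : nat -> nat).
Local Notation word_form := (@word_form R d N tau).

Lemma word_form1 : word_form mone = unit_form R d N.
Proof. by rewrite /Defs.word_form fm1 big_nil. Qed.

Lemma word_form_cons i r :
  word_form (mmul (letter i) r) = convolution (to_dual N (tau i)) (word_form r).
Proof. by rewrite /Defs.word_form fmM fmU big_cons. Qed.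

Lemma word_ind (P : {fmonom nat} -> Prop) :
  P mone -> (forall i r, P r -> P (mmul (letter i) r)) -> forall r, P r.
Proof.
move=> P1 PM [s]; elim: s => [|i s IH].
  by rewrite -(_ : mone = FMonom [::]) //; apply/eqP; rewrite fmP fm1.
rewrite -(_ : mmul (letter i) (FMonom s) = FMonom (i :: s)); first exact: PM.
by apply/eqP; rewrite fmP fmM fmU.
Qed.

Lemma word_formM r r' :
  word_form (mmul r r') = convolution (word_form r) (word_form r').
Proof.
elim/word_ind: r => [|i r IH]; first by rewrite mul1m word_form1 convolution1l.
by rewrite -mulmA !word_form_cons IH convolutionA.
Qed.

Lemma word_sizeM r r' :
  word_size sz (mmul r r') = (word_size sz r + word_size sz r')%N.
Proof. by rewrite /word_size fmM big_cat. Qed.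

Lemma word_size_letter i : word_size sz (letter i) = sz i.
Proof. by rewrite /word_size fmU big_seq1. Qed.

Lemma word_mul_linext (x y : {malg R[{fmonom nat}]}) :
  truncate (x * y)
  = linext (fun r => linext (fun r' => tbasis (mmul r r') : TN R sz N) y) x.
Proof.
rewrite malgM_linext /truncate linear_linext; apply: eq_linext => r _ /=.
by rewrite linear_linext; apply: eq_linext => r' _; rewrite /= linextU.
Qed.

(** No size bound is imposed: if the letter or the tail exceeds $N$, so does the whole word, and
    both sides are 0. Inductions on words thus need no bound on the tail. *)
Lemma word_mul_letter i r :
  word_mul (tbasis (letter i)) (tbasis r)
  = tbasis (mmul (letter i) r) :> TN R sz N.
Proof.
have wE := word_sizeM (letter i) r; rewrite word_size_letter in wE.
rewrite /word_mul; case: (leqP (sz i) N) => iN; last first.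
  rewrite [tbasis (letter i)]tbasis_gt ?word_size_letter // mul0r.
  by rewrite tbasis_gt ?wE ?ltn_addr // /truncate linear0.
case: (leqP (word_size sz r) N) => rN; last first.
  rewrite [tbasis r]tbasis_gt // mulr0.
  by rewrite tbasis_gt ?wE ?ltn_addl // /truncate linear0.
by rewrite !mval_tbasis ?word_size_letter // -mbasisM /truncate linextU.
Qed.

Hypothesis tau_size : forall i,
  {in msupp (tau i), forall f, forest_size f = sz i}.

Lemma homogeneous_word_form r : homogeneous (word_size sz r) (word_form r).
Proof.
elim/word_ind: r => [|i r IH].
  by rewrite word_form1 /word_size fm1 big_nil; exact: homogeneous_unit.
rewrite word_form_cons word_sizeM word_size_letter.
by apply: homogeneous_convolution IH; apply: homogeneous_to_dual.
Qed.

(** The counterpart in the dual of setting long words to 0; it removes the size bound from the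
    description of [Psi] on words. *)
Lemma word_form_gt r : (N < word_size sz r)%N -> word_form r = 0.
Proof. by move/homogeneous_gt; apply; exact: homogeneous_word_form. Qed.

Variable Psi : {linear HNdual R d N -> TN R sz N}.
Hypothesis PsiE : forall r, (word_size sz r <= N)%N ->
  Psi (word_form r) = tbasis r.

Lemma Psi_word_form r : Psi (word_form r) = tbasis r.
Proof.
case: (leqP (word_size sz r) N) => rN; first exact: PsiE.
by rewrite word_form_gt // linear0 tbasis_gt.
Qed.

(** Hence [Psi] reads off the coefficients $\lambda_R$ of a form expanded in words. *)
Lemma Psi_linext_word_form (c : TN R sz N) :
  Psi (linext word_form (mval c)) = c.
Proof.
rewrite linear_linext -[RHS]linext_tbasis.
by apply: eq_linext => r _; exact: Psi_word_form.
Qed.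

Hypothesis words_span : forall Y : HNdual R d N,
  exists c : TN R sz N, Y = linext word_form (mval c).

(** By bilinearity it suffices to compare words, where convolution of word forms is the form of the
    concatenated word. *)
Lemma Psi_convolution X Y :
  Psi (convolution X Y) = word_mul (Psi X) (Psi Y).
Proof.
have [[c ->] [c' ->]] := (words_span X, words_span Y).
rewrite convolution_linext !Psi_linext_word_form /word_mul word_mul_linext.
rewrite linear_linext; apply: eq_linext => r _ /=.
rewrite linear_linext; apply: eq_linext => r' _ /=.
by rewrite -word_formM Psi_word_form.
Qed.

End Words.

Theorem theorem4p7 (R : realType) (d N : nat) (gamma : R)
  (gamma01 : 0 < gamma < 1)
  (NE : N%:Z = Num.floor (1 / gamma))
  (X : R -> R -> HNdual R d N)
  (X_rough : branched_rough_path gamma X)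
  (tau : nat -> {malg R[forest d]}) (sz sz0 : nat -> nat)
  (tau_basis : Foissy_Chapoton_basis N tau sz sz0)
  (Psi : {linear HNdual R d N -> TN R sz N})
  (PsiE : forall r : {fmonom nat}, (word_size sz r <= N)%N ->
    Psi (word_form N tau r) = tbasis r)
  (M : {linear HN R d N -> HN R d N})
  (M_one : M (tbasis mone) = tbasis mone)
  (M_mul : forall f h k : HN R d N,
    mval k = mval f * mval h -> mval (M k) = mval (M f) * mval (M h))
  (M_coproduct : forall x : HN R d N,
    tensor_map M (coproduct (mval x)) = coproduct (mval (M x)))
  (M_trees : forall t : tree d, (tree_size t <= N)%N ->
    forall f, f \in msupp (mval (M (tbasis (ucm t)))) ->
    exists t' : tree d, [/\ f = ucm t',
      tree_weight gamma t <= tree_weight gamma t'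
      & (tree_size t' <= tree_size t)%N])
  (Mt : {linear TN R sz N -> TN R sz N})
  (Mt_empty : Mt (tbasis mone) = tbasis mone)
  (Mt_mul : forall u v : TN R sz N,
    Mt (word_mul u v) = word_mul (Mt u) (Mt v))
  (Mt_letter : forall i : nat, (sz i <= N)%N ->
    Mt (tbasis (letter i)) = Psi (adjoint M (to_dual N (tau i)))) :
  forall s t : R, 0 <= s <= 1 -> 0 <= t <= 1 ->
    Psi (adjoint M (X s t)) = Mt (Psi (X s t)).
Proof.
have tau_size i : {in msupp (tau i), forall f, forest_size f = sz i}.
  by move=> f /(FC_trees tau_basis)[t [-> <- _]]; rewrite forest_sizeU.
have words_span Y : exists c : TN R sz N, Y = linext (word_form N tau) (mval c).
  by have [c [-> _]] := FC_words tau_basis Y; exists c.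
have PsiW := Psi_word_form tau_size PsiE.
(* By [M_trees], the image of a tree is supported on trees, and a tree is never the empty forest. *)
have M_unit : adjoint M (unit_form R d N) = unit_form R d N.
  apply: adjoint_unit => // t tN; apply/negP => /(M_trees t tN)[t' [/esym/eqP]].
  by rewrite cm1_eq1.
(* Both sides are unital and multiplicative, so induction on the word reduces the claim to single
   letters. *)
have PsiM r : Psi (adjoint M (word_form N tau r)) = Mt (tbasis r).
  elim/word_ind: r => [|i r IH].
    by rewrite word_form1 M_unit Mt_empty -(word_form1 N tau) PsiW.
  rewrite word_form_cons (adjoint_convolution _ _ M_coproduct).
  rewrite (Psi_convolution tau_size PsiE words_span) IH -word_mul_letter Mt_mul.
  case: (leqP (sz i) N) => iN; first by rewrite Mt_letter.
  (* [Mt_letter] says nothing about a letter with more than $N$ nodes, but its form and its basis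
     word are both 0. *)
  have -> : to_dual N (tau i) = 0.
    by apply: (homogeneous_gt iN); apply: homogeneous_to_dual.
  rewrite (_ : adjoint M 0 = 0) ?linear0; last exact: dualP.
  by rewrite [tbasis (letter i)]tbasis_gt ?word_size_letter // linear0.
(* It remains to expand [X s t] in words and to move both linear maps inside the expansion; for this
   the adjoint is packed as a linear map. *)
move=> s t _ _; have [c ->] := words_span (X s t).
rewrite Psi_linext_word_form // (linear_tmalgE Mt).
have adjoint_linear : linear (adjoint M) by move=> a Y Z; apply: dualP.
pose Madj : {linear HNdual R d N -> HNdual R d N} :=
  HB.pack (adjoint M) (GRing.isLinear.Build _ _ _ _ _ adjoint_linear).
rewrite -[adjoint M _]/(Madj _) !linear_linext.
by apply: eq_linext => r _; exact: PsiM.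
Qed.
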